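(* Let $A$ and $S$ be finite sets, let $f:A\to A$ be a map, and let $\varphi:A\to S$ be a surjective map. Then $f$ is a bijection if and only if the following two conditions hold: (i) $f$ is injective on $\varphi^{-1}(s)$ for every $s\in S$; (ii) for each bijection $h:S\to S$ there exists a uniquely determined surjective map $\psi:A\to S$ such that $\psi\circ f=h\circ\varphi$. *)

(* Defs.v *)
From mathcomp Require Import all_boot.

Set Implicit Arguments.
Unset Strict Implicit.
Unset Printing Implicit Defensive.

Definition surjective (T U : Type) (f : T -> U) : Prop :=
  forall y : U, exists x : T, f x = y.

(* Main.v *)
Require Import Defs.
From mathcomp Require Import all_boot.

Set Implicit Arguments.
Unset Strict Implicit.
Unset Printing Implicit Defensive.

(** For bijective [f], the equation forces [psi] to be [h \o phi \o f^-1], a composite of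
    surjections. Conversely, (ii) makes [f] separate distinct fibres of [phi] and (i) makes it
    separate points within a fibre, so [f] is injective, hence bijective as [A] is finite. *)

Theorem theorem3p1 (A S : finType) (f : A -> A) (phi : A -> S)
    (phi_surj : surjective phi) :
  bijective f <->
  (forall s : S, {in phi @^-1: [set s] &, injective f}) /\
  (forall h : S -> S, bijective h ->
     exists! psi : {ffun A -> S}, surjective psi /\ psi \o f =1 h \o phi).
Proof.
split=> [f_bij|[f_inj psi_ex]].
  have [g fK gK] := f_bij.
  split=> [s x y _ _|h [k hK kK]]; first exact: (can_inj fK).
  exists [ffun a => h (phi (g a))]; split.
    split=> [s|a]; last by rewrite /= ffunE fK.
    (* A preimage of [s] is [f a], with [a] in the fibre over [k s], where [k] inverts [h]. *)
    by have [a phia] := phi_surj (k s); exists (f a); rewrite ffunE fK phia kK.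
  move=> psi [_ psif]; apply/ffunP=> a.
  by rewrite ffunE -[in RHS](gK a); apply/esym/psif.
(* With h = id, phi factors through f, so f x = f y puts x and y in one fibre. *)
have [psi [[_ psif] _]] := psi_ex id (Bijective (frefl id) (frefl id)).
apply: injF_bij => x y eqf.
have eq_phi : phi x = phi y.
  by rewrite -[phi x]psif -[phi y]psif /= eqf.
by apply: (f_inj (phi y)) eqf; rewrite !inE ?eq_phi.
Qed.
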